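(* (1) If $q=2^n$ with $n$ even, then every maximal clique of $\Gamma$ has size $q$ or $4$; when $q>4$, the maximal cliques of size $q$ are linear and the maximal cliques of size $4$ are non-linear. (2) If $q=2^n>2$ with $n$ odd, then every maximal clique of $\Gamma$ has size $q$ or $6$; the cliques of size $q$ are linear and the maximal cliques of size $6$ are non-linear. (3) For every $q$, every non-linear $3$-clique of $\Gamma$ is contained in exactly $q+1$ non-linear $4$-cliques. (4) If $n$ is odd, then every non-linear $4$-clique is contained in exactly two $5$-cliques of $\Gamma$, and every non-linear $5$-clique is contained in exactly one $6$-clique of $\Gamma$.
   Context: Let $q=2^n$ and let $Q_0\cong Q(4,q)$ be the parabolic quadric generalized quadrangle in $\mathrm{PG}(4,q)$. An elliptic ovoid of $Q_0$ is a set $X=S\cap Q_0$ where $S$ is a $3$-dimensional projective subspace meeting $Q_0$ in an elliptic quadric $Q^-(3,q)$. Two distinct elliptic ovoids meet in one point (then they are tangent) or in a conic. A rosette based at $p\in Q_0$ is a set of $q$ elliptic ovoids pairwise meeting exactly in $\{p\}$. $\Gamma$ is the graph whose vertices are the elliptic ovoids of $Q_0$, adjacent iff distinct and tangent. A clique of $\Gamma$ is linear if it is contained in some rosette, non-linear otherwise; an $i$-clique is a clique with $i$ vertices. *)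

(* Defs.v *)
From HB Require Import structures.
From mathcomp Require Import all_boot all_order all_algebra all_field.
Set Implicit Arguments. Unset Strict Implicit. Unset Printing Implicit Defensive.
Import GRing.Theory.
Local Open Scope ring_scope.

Definition cf (F : finFieldType) (k : nat) (v : 'rV[F]_5) : F := v ord0 (inord k).

(* The parabolic quadric Q(4,q) in standard form x0^2 + x1 x2 + x3 x4 = 0. *)
Definition Qform (F : finFieldType) (v : 'rV[F]_5) : F :=
  cf 0 v ^+ 2 + cf 1 v * cf 2 v + cf 3 v * cf 4 v.

(* A projective point of PG(4,q) is represented by its normalized coordinate
   vector: nonzero, first nonzero coordinate equal to 1. *)
Definition is_point (F : finFieldType) (v : 'rV[F]_5) : bool :=
  [exists i : 'I_5, (v ord0 i == 1) &&
     [forall j : 'I_5, ((j < i)%N ==> (v ord0 j == 0))]].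

Definition Q0 (F : finFieldType) : {set 'rV[F]_5} :=
  [set v | is_point v && (Qform v == 0)].

Definition ell_form (F : finFieldType) (d : F) (w : 'rV[F]_4) : F :=
  w ord0 (inord 0) ^+ 2 + w ord0 (inord 0) * w ord0 (inord 1)
  + d * w ord0 (inord 1) ^+ 2 + w ord0 (inord 2) * w ord0 (inord 3).

(* X is an elliptic ovoid: X = S ∩ Q0 where S (the row space of the rank-4
   matrix M, a solid of PG(4,q)) meets Q0 in an elliptic quadric Q^-(3,q),
   i.e. in suitable coordinates on S the restriction of the quadratic form is
   (a nonzero multiple of) x0^2 + x0 x1 + d x1^2 + x2 x3 with X^2+X+d
   irreducible. *)
Definition elliptic_ovoid (F : finFieldType) (X : {set 'rV[F]_5}) : Prop :=
  exists M : 'M[F]_(4, 5),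
    [/\ \rank M = 4%N,
        (exists c d : F, [/\ c != 0,
            irreducible_poly ('X^2 + 'X + d%:P) &
            forall w : 'rV[F]_4, Qform (w *m M) = c * ell_form d w]) &
        X = [set v | (v \in Q0 F) && (v <= M)%MS]].

Definition clique (F : finFieldType) (C : {set {set 'rV[F]_5}}) : Prop :=
  (forall X, X \in C -> elliptic_ovoid X) /\
  (forall X Y, X \in C -> Y \in C -> X != Y -> #|X :&: Y| = 1%N).

Definition maximal_clique (F : finFieldType) (C : {set {set 'rV[F]_5}}) : Prop :=
  clique C /\ (forall D, clique D -> C \subset D -> D = C).

Definition rosette (F : finFieldType) (R : {set {set 'rV[F]_5}}) : Prop :=
  exists p : 'rV[F]_5, [/\ p \in Q0 F, #|R| = #|F|,
     (forall X, X \in R -> elliptic_ovoid X) &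
     (forall X Y, X \in R -> Y \in R -> X != Y -> X :&: Y = [set p])].

Definition linear_clique (F : finFieldType) (C : {set {set 'rV[F]_5}}) : Prop :=
  clique C /\ exists R, rosette R /\ C \subset R.

Definition nonlinear_clique (F : finFieldType) (C : {set {set 'rV[F]_5}}) : Prop :=
  clique C /\ ~ (exists R, rosette R /\ C \subset R).

Definition count_eq (T : finType) (P : T -> Prop) (k : nat) : Prop :=
  exists A : {set T}, #|A| = k /\ (forall x, x \in A <-> P x).

(* Main.v *)
Require Import Defs.
From HB Require Import structures.
From mathcomp Require Import all_boot all_order all_algebra all_field.
From mathcomp Require Import all_fingroup all_solvable ring zify.
Import GRing.Theory.
Set Implicit Arguments. Unset Strict Implicit. Unset Printing Implicit Defensive.

(* The nucleus of the quadric x0^2 + x1 x2 + x3 x4 = 0 is the point e0, so the solids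
   meeting it in an elliptic quadric have equations x0 = B(a, x) with a in F^4, where B is the
   polar form of P(x) = x1 x2 + x3 x4 and f_a(x) = B(a, x)^2 + P(x) is elliptic.  The ovoids
   of a <> b are tangent iff f_a(a + b) = 0, and then the tangency point is spanned by a + b;
   the transvection with centre c carries f_(a+c) to f_a whenever f_a(c) = 0.  Hence, for
   f_a-singular c and c', the ovoids of a + c and a + c' are tangent iff B(c, c') is 0 or 1,
   and 0 occurs exactly when c and c' are proportional, which is the linear case.

   A non-linear triangle is therefore a, a + c1, a + c2 with B(c1, c2) = 1, and its common
   neighbours are a + c1 + c2 + z, where z lies in the anisotropic plane W orthogonal to c1
   and c2 and f_a(z) = 1: there are q + 1 of them.  Those adjacent to a given z correspond to
   the w in W with f_a(w) = 1 and B(z, w) = 1, that is, to the roots t of t^2 + t = d + 1,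
   where t^2 + t = d has no root.  The image of t |-> t^2 + t has index 2 and contains 1 iff
   n is even, so there are none when n is even, and two mutually adjacent ones when n is odd. *)

(** * The map t^2 + t in characteristic 2 *)

Section ArtinSchreier.
Local Open Scope ring_scope.
Context (F : finFieldType) (two0 : 2%:R = 0 :> F).

Lemma addrr0 (V : lmodType F) (x : V) : x + x = 0.
Proof. by rewrite -mulr2n -scaler_nat two0 scale0r. Qed.

Lemma oppr_id (V : lmodType F) (x : V) : - x = x.
Proof. by apply/eqP; rewrite eq_sym -addr_eq0 addrr0. Qed.

Lemma add_eq0 (V : lmodType F) (x y : V) : (x + y == 0) = (x == y).
Proof. by rewrite addr_eq0 oppr_id. Qed.

Lemma addff (x : F) : x + x = 0.
Proof. exact: (@addrr0 F^o). Qed.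

Lemma addf_eq0 (x y : F) : (x + y == 0) = (x == y).
Proof. exact: (@add_eq0 F^o). Qed.

Lemma sqr_inj : injective (fun x : F => x ^+ 2).
Proof.
move=> x y /= /eqP; rewrite -addf_eq0 => h.
apply/eqP; rewrite -addf_eq0 -sqrf_eq0 -(eqP h).
by apply/eqP; ring: two0.
Qed.

Lemma sqrt_ex (x : F) : exists y, y ^+ 2 = x.
Proof.
have [g _ K] := injF_bij sqr_inj.
by exists (g x); rewrite K.
Qed.

(** The Artin-Schreier map: additive, with kernel {0, 1}. *)
Definition wp (t : F) : F := t ^+ 2 + t.

Lemma wpD s t : wp (s + t) = wp s + wp t.
Proof. by rewrite /wp; ring: two0. Qed.

Lemma wp_eq s t : (wp s == wp t) = (s == t) || (s == t + 1).
Proof.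
rewrite -(addf_eq0 (wp s)) -(addf_eq0 s t) -(addf_eq0 s (t + 1)) -mulf_eq0.
by congr (_ == 0); rewrite /wp; ring: two0.
Qed.

(** Fibres have the form {t, t + 1}, so [wp t] together with one bit, telling whether [t] is the
    element picked in its fibre, determines [t]. *)
Lemma card_wp_image : (#|F| <= #|[set wp t | t : F]| * 2)%N.
Proof.
pose g t : F * bool := (wp t, t == odflt 0 [pick s | wp s == wp t]).
have g_inj : injective g.
  move=> s t [e]; rewrite -e; case: pickP => [r /eqP er|/(_ s)]; last by rewrite eqxx.
  rewrite /=; have [->|sr] := eqVneq s r; first by move/esym/eqP.
  (* Neither [s] nor [t] is the picked element [r], so both are [r + 1]. *)
  move/esym/negbT=> tr.
  have /eqP := er; have /eqP := etrans er e.
  rewrite ![wp r == _]eq_sym !wp_eq (negbTE sr) (negbTE tr) /=.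
  by move=> /eqP -> /eqP ->.
rewrite -cardsT -(card_imset _ g_inj).
have -> : 2%N = #|[set: bool]| by rewrite cardsT card_bool.
rewrite -cardsX.
apply/subset_leq_card/subsetP => _ /imsetP[t _ ->].
by rewrite inE /= in_setT andbT imset_f.
Qed.

(* The image of [wp] and its translate by [u] are disjoint and already fill [F]. *)
Lemma wp_index2 u v :
  (forall t, wp t != u) -> (forall t, wp t != v) -> exists t, wp t = u + v.
Proof.
move=> hu hv; pose S := [set wp t | t : F].
have dis : [disjoint S & [set u + s | s in S]].
  rewrite -setI_eq0; apply/eqP/setP=> x; rewrite !inE; apply/negP.
  case/andP=> /imsetP[s _ ->] /imsetP[_ /imsetP[t _ ->] e].
  by have /eqP[] := hu (s + t); rewrite wpD e -addrA addff addr0.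
have full : S :|: [set u + s | s in S] = setT.
  apply/eqP; rewrite eqEcard subsetT cardsT cardsU.
  rewrite (disjoint_setI0 dis) cards0 subn0 (card_imset S (@addrI F u)).
  by rewrite addnn -muln2 andTb; exact: card_wp_image.
have: v \in S :|: [set u + s | s in S] by rewrite full in_setT.
rewrite inE => /orP[] /imsetP[t]; first by move=> _ e; have := hv t; rewrite -e eqxx.
move=> /imsetP[s _ ->] ->; exists s.
by rewrite addrA addff add0r.
Qed.

(** A surjective self-map of a finite set is injective, but [wp 0 = wp 1]. *)
Lemma wp_nonsurj : exists d, forall t, wp t != d.
Proof.
have [|] := boolP [exists d, [forall t, wp t != d]].
  by move=> /existsP[d /forallP h]; exists d.
rewrite negb_exists => /forallP h; exfalso.
have onto d : d \in codom wp.
  have := h d; rewrite negb_forall => /existsP[t]; rewrite negbK => /eqP <-.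
  exact: codom_f.
have /injectiveP inj : injectiveb wp.
  rewrite /injectiveb /dinjectiveb; apply/card_uniqP; rewrite size_map -cardE.
  by apply: eq_card => x; rewrite inE; exact: onto.
have /eqP : wp 0 == wp 1 by rewrite wp_eq addff eqxx orbT.
by move/inj/eqP; rewrite eq_sym oner_eq0.
Qed.

(** A solution would be a cube root of unity. For odd n, 2^n is 2 modulo 3, so t = t^q = t^2, and
    then [wp t] is 0 rather than 1. *)
Lemma wp_one_odd n : #|F| = (2 ^ n)%N -> odd n -> forall t, wp t != 1.
Proof.
move=> cF on t; apply/eqP; rewrite /wp => e.
have t3 : t ^+ 3 = 1.
  have -> : t ^+ 3 = t * (t ^+ 2 + t) + (t ^+ 2 + t) + t by ring: two0.
  by rewrite e; ring: two0.
have [k ek] : exists k, (2 ^ n = 3 * k + 2)%N.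
  exists (2 ^ n %/ 3)%N; rewrite [LHS](divn_eq _ 3) mulnC; congr (_ + _)%N.
  rewrite -(odd_double_half n) on expnS -mul2n expnM -modnMmr -modnXm.
  by rewrite exp1n.
have tq : t ^+ #|F| = t := expf_card t.
have : t ^+ 2 = t by rewrite -[in RHS]tq cF ek exprD exprM t3 expr1n mul1r.
move=> t2; have t0 : t ^+ 2 + t = 0 by rewrite t2 addff.
by have := oner_neq0 F; rewrite -e t0 eqxx.
Qed.

(** For even n, 3 divides q - 1, so there is a unit u of order 3; it is a root of (u^3 + 1)/(u + 1)
    = u^2 + u + 1. *)
Lemma wp_one_even n : #|F| = (2 ^ n)%N -> (0 < n)%N -> ~~ odd n -> exists t, wp t = 1.
Proof.
move=> cF n0 en.
have d3 : (3 %| #|[set: {unit F}]|)%N.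
  rewrite card_finField_unit cF -subn1 -eqn_mod_dvd ?expn_gt0 //.
  by rewrite -(odd_double_half n) (negbTE en) add0n -mul2n expnM -modnXm exp1n.
have [u _ ou] := Cauchy (isT : prime 3) d3.
exists (val u); have u3 : val u ^+ 3 = 1.
  by rewrite -FinRing.val_unitX -ou expg_order.
have u1 : val u + 1 != 0.
  rewrite addf_eq0; apply/eqP=> e.
  have /eqP : u = 1%g by apply: val_inj.
  by rewrite -order_eq1 ou.
apply: (mulfI u1); apply/eqP; rewrite -addf_eq0 mulr1.
have -> : (val u + 1) * wp (val u) + (val u + 1) = val u ^+ 3 + 1 by rewrite /wp; ring: two0.
by rewrite u3 addff.
Qed.

End ArtinSchreier.

(** * The forms f_a on F^4 and their common polar form *)

Section Forms.
Local Open Scope ring_scope.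
Context (F : finFieldType) (two0 : 2%:R = 0 :> F).
Local Notation V := 'rV[F]_4.
Implicit Types (a b c d x y z w : V) (s t : F).

Definition co x k : F := x ord0 (inord k).

Definition hyp x : F := co x 0 * co x 1 + co x 2 * co x 3.

Definition pol x y : F :=
  co x 0 * co y 1 + co x 1 * co y 0 + co x 2 * co y 3 + co x 3 * co y 2.

(* [Qform] on the solid x0 = pol a (x1, x2, x3, x4), in the coordinates x1, ..., x4. *)
Definition eform a x : F := pol a x ^+ 2 + hyp x.

Lemma coD x y k : co (x + y) k = co x k + co y k.
Proof. by rewrite /co mxE. Qed.

Lemma coZ t x k : co (t *: x) k = t * co x k.
Proof. by rewrite /co mxE. Qed.

Lemma co_inj x y : (forall k, (k < 4)%N -> co x k = co y k) -> x = y.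
Proof.
move=> h; apply/rowP=> i; have := h i (ltn_ord i).
by rewrite /co inord_val.
Qed.

Lemma polDl x y z : pol (x + y) z = pol x z + pol y z.
Proof. by rewrite /pol !coD; ring. Qed.
Lemma polDr x y z : pol z (x + y) = pol z x + pol z y.
Proof. by rewrite /pol !coD; ring. Qed.
Lemma polZl t x y : pol (t *: x) y = t * pol x y.
Proof. by rewrite /pol !coZ; ring. Qed.
Lemma polZr t x y : pol x (t *: y) = t * pol x y.
Proof. by rewrite /pol !coZ; ring. Qed.
Lemma polC x y : pol x y = pol y x.
Proof. by rewrite /pol; ring. Qed.
Lemma polxx x : pol x x = 0.
Proof. by rewrite /pol; ring: two0. Qed.
Let polE := (polDl, polDr, polZl, polZr, polxx).

Lemma hypD x y : hyp (x + y) = hyp x + hyp y + pol x y.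
Proof. by rewrite /hyp /pol !coD; ring. Qed.
Lemma hypZ t x : hyp (t *: x) = t ^+ 2 * hyp x.
Proof. by rewrite /hyp !coZ; ring. Qed.

Lemma eformD a x y : eform a (x + y) = eform a x + eform a y + pol x y.
Proof. by rewrite /eform hypD polDr; ring: two0. Qed.
Lemma eformZ a t x : eform a (t *: x) = t ^+ 2 * eform a x.
Proof. by rewrite /eform hypZ polZr; ring. Qed.
Lemma eform0 a : eform a 0 = 0.
Proof. by rewrite -(scale0r 0) eformZ expr0n mul0r. Qed.

Lemma pol_eq0 x : (forall y, pol x y = 0) -> x = 0.
Proof.
move=> h; have co_e j k : (j < 4)%N -> (k < 4)%N ->
    co (delta_mx ord0 (inord j)) k = (k == j)%:R.
  by move=> hj hk; rewrite /co mxE eqxx -val_eqE /= !inordK.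
apply: co_inj => k hk; rewrite {2}/co mxE.
(* The list sends [k] to its hyperbolic partner; pairing with that basis vector reads off coordinate
   [k]. *)
have := h (delta_mx ord0 (inord (nth 0 [:: 1; 0; 3; 2]%N k))).
by move: k hk => [|[|[|[|k]]]] //= _ <-; rewrite /pol !co_e //=; ring.
Qed.

Lemma pol_nondeg x : x != 0 -> exists y, pol x y = 1.
Proof.
move=> x0; have [|] := boolP [exists y : V, pol x y != 0].
  by move=> /existsP[y hy]; exists ((pol x y)^-1 *: y); rewrite polZr mulVf.
rewrite negb_exists => /forallP h; case/negP: x0; apply/eqP/pol_eq0 => y.
by apply/eqP; rewrite -[_ == _]negbK.
Qed.

(** A symplectic basis made of two orthogonal hyperbolic pairs; below, [z] and [w] span the plane W
    of the overview. *)
Definition hbasis c1 c2 z w :=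
  [/\ pol c1 c2 = 1, pol z w = 1, pol c1 z = 0, pol c1 w = 0
    & pol c2 z = 0 /\ pol c2 w = 0].

(** By the pairing relations, [phi] recovers the coefficients of a combination [psi r]. Between
    finite sets of the same size this one-sided inverse is two-sided, so every vector is such a
    combination. *)
Lemma hbasis_expand c1 c2 z w : hbasis c1 c2 z w -> forall x,
  x = pol c2 x *: c1 + pol c1 x *: c2 + pol w x *: z + pol z x *: w.
Proof.
move=> [h1 h2 h3 h4 [h5 h6]].
pose phi (x : V) : V := \row_(i < 4) pol (nth 0 [:: c2; c1; w; z] i) x.
pose psi (r : V) : V := co r 0 *: c1 + co r 1 *: c2 + co r 2 *: z + co r 3 *: w.
have K : cancel psi phi.
  move=> r; apply/rowP => i; rewrite mxE /psi !polE.
  have -> : r ord0 i = co r i by rewrite /co inord_val.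
  case: i => [[|[|[|[|i]]]] //= _].
  - by rewrite polxx (polC c2 c1) h1 h5 h6; ring.
  - by rewrite polxx h1 h3 h4; ring.
  - by rewrite polxx (polC w c1) (polC w c2) (polC w z) h2 h4 h6; ring.
  - by rewrite polxx (polC z c1) (polC z c2) h2 h3 h5; ring.
move=> x; rewrite -[LHS](canF_sym K x) /psi /co !mxE.
by rewrite !inordK.
Qed.

(** Any [u] with B(z, u) = 1 is made orthogonal to [c1] and [c2] by subtracting its components along
    them, which leaves B(z, u) unchanged. *)
Lemma hbasis_complete c1 c2 z : pol c1 c2 = 1 -> z != 0 -> pol c1 z = 0 ->
  pol c2 z = 0 -> exists w, hbasis c1 c2 z w.
Proof.
move=> h1 z0 h3 h5; have [u hu] := pol_nondeg z0.
exists (u + pol c2 u *: c1 + pol c1 u *: c2); split => //; last split => //; rewrite ?polE.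
- by rewrite (polC z c1) (polC z c2) h3 h5 hu; ring.
- by rewrite h1; ring: two0.
- by rewrite (polC c2 c1) h1; ring: two0.
Qed.

(** Two linear conditions on a space of dimension 4: [M] has rank at most 2. *)
Lemma orth_ex c1 c2 : exists z, [/\ z != 0, pol c1 z = 0 & pol c2 z = 0].
Proof.
pose M : 'M[F]_(4, 2) := \matrix_(i, j) pol (nth 0 [:: c1; c2] j) (delta_mx ord0 i).
have : kermx M != 0.
  rewrite -mxrank_eq0 mxrank_ker -lt0n subn_gt0.
  exact: leq_ltn_trans (rank_leq_col M) _.
move/rowV0Pn=> [z /sub_kermxP zM z0]; exists z.
have lin c : pol c z = \sum_i z ord0 i * pol c (delta_mx ord0 i).
  rewrite {1}(row_sum_delta z); elim/big_rec2: _ => [|i s t _ <-].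
    by rewrite -(scale0r 0) polZr mul0r.
  by rewrite polDr polZr.
have e j : pol (nth 0 [:: c1; c2] (j : 'I_2)) z = 0.
  have /rowP/(_ j) := zM; rewrite !mxE lin => {2}<-.
  by apply: eq_bigr => i _; rewrite mxE.
by split => //; [apply: (e ord0) | apply: (e (Ordinal (isT : (1 < 2)%N)))].
Qed.
End Forms.

(** * Tangency as a relation between vectors *)

Section Tangency.
Local Open Scope ring_scope.
Context (F : finFieldType) (two0 : 2%:R = 0 :> F).
Local Notation V := 'rV[F]_4.
Implicit Types (a b c d x y z w : V) (s t : F) (A : {set V}).
Let polE := (polDl, polDr, polZl, polZr, polxx two0).
Local Notation eformD := (eformD two0).

(* Ellipticity as the absence of totally singular lines; see [elliptic_ovoidP]. *)
Definition ell a : bool :=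
  [forall x : V, forall y : V,
    [&& eform a x == 0, eform a y == 0, pol x y == 0 & x != 0] ==>
    [exists t : F, y == t *: x]].

Lemma ellP a :
  reflect (forall x y, eform a x = 0 -> eform a y = 0 -> pol x y = 0 -> x != 0 ->
             exists t, y = t *: x) (ell a).
Proof.
apply: (iffP forallP) => [h x y hx hy hxy x0|h x].
  have /forallP/(_ y) := h x; rewrite hx hy hxy x0 !eqxx => /existsP[t /eqP e].
  by exists t.
apply/forallP => y; apply/implyP => /and4P[/eqP hx /eqP hy /eqP hxy x0].
by have [t e] := h x y hx hy hxy x0; apply/existsP; exists t; apply/eqP.
Qed.

Lemma eform_translate a c x : eform (a + c) x = eform a x + pol c x ^+ 2.
Proof. by rewrite /eform polDl; ring: two0. Qed.

(* The transvection [x + pol c x *: c] is an isometry of [pol] carrying [eform (a + c)]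
   to [eform a]. *)
Lemma ell_translate a c : ell a -> eform a c = 0 -> ell (a + c).
Proof.
move=> /ellP ea fc; pose tau x := x + pol c x *: c.
have tau_form x : eform a (tau x) = eform (a + c) x.
  by rewrite /tau eformD eformZ fc polZr (polC x c) eform_translate; ring.
have tau_pol x y : pol (tau x) (tau y) = pol x y.
  by rewrite /tau !polE (polC x c); ring: two0.
have tauZ t x : tau (t *: x) = t *: tau x.
  by rewrite /tau polZr scalerDr scalerA.
have tauK : involutive tau.
  by move=> x; rewrite {1}/tau [pol c _]polE !polE mulr0 addr0 /tau -addrA (addrr0 two0) addr0.
have tau0 : tau 0 = 0 by rewrite -(scale0r 0) tauZ !scale0r.
apply/ellP => x y; rewrite -!tau_form -[pol x y]tau_pol => hx hy hxy x0.
have tx0 : tau x != 0 by apply: contraNneq x0 => e; rewrite -(tauK x) e tau0.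
have [t e] := ea _ _ hx hy hxy tx0.
by exists t; rewrite -(tauK y) e tauZ tauK.
Qed.

(* Tangency of the ovoids [ov a] and [ov b]; see [tangentE]. *)
Definition adj a b : bool := (a != b) && (eform a (a + b) == 0).

Lemma addKK a b : a + (a + b) = b :> V.
Proof. by rewrite addrA (addrr0 two0) add0r. Qed.

Lemma adjC a b : adj a b = adj b a.
Proof.
by rewrite /adj eq_sym (addrC b) /eform !polDr !(polxx two0) (polC b a) addr0 add0r.
Qed.

Lemma adj_ell a b : ell a -> adj a b -> ell b.
Proof.
by move=> ea /andP[_ /eqP h]; rewrite -(addKK a b); exact: ell_translate.
Qed.

(** The form of [a + c] at [c + c'] is B(c, c') + B(c, c')^2, since f_a vanishes at both vectors and
    B(c, c) = 0. *)
Lemma adj_cone a c c' : eform a c = 0 -> eform a c' = 0 ->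
  adj (a + c) (a + c') = (c != c') && (wp (pol c c') == 0).
Proof.
move=> fc fc'; rewrite /adj (inj_eq (addrI a)).
have -> : a + c + (a + c') = c + c' by rewrite addrACA (addrr0 two0) add0r.
by rewrite eform_translate eformD fc fc' polDr (polxx two0) /wp !add0r addrC.
Qed.

Lemma wp_eq0 t : (wp t == 0) = (t == 0) || (t == 1).
Proof.
have -> : wp t = t * (t + 1) by rewrite /wp; ring.
by rewrite mulf_eq0 (addf_eq0 two0).
Qed.

(** The vectors [e0] and [e2] span a plane on which P vanishes. There f_a is the square of a linear
    functional, which has a nonzero zero. *)
Lemma isotropic_ex a : exists2 x, x != 0 & eform a x = 0.
Proof.
pose e0 : V := delta_mx ord0 (inord 0); pose e2 : V := delta_mx ord0 (inord 2).
have co0 k : (k < 4)%N -> co e0 k = (k == 0%N)%:R.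
  by move=> hk; rewrite /co mxE eqxx -val_eqE /= !inordK.
have co2 k : (k < 4)%N -> co e2 k = (k == 2%N)%:R.
  by move=> hk; rewrite /co mxE eqxx -val_eqE /= !inordK.
have f0 : hyp e0 = 0 by rewrite /hyp !co0 //=; ring.
have [b0|b0] := eqVneq (pol a e0) 0.
  exists e0; last by rewrite /eform b0 f0 addr0 expr0n.
  apply/eqP => /(congr1 (fun v => co v 0)); rewrite co0 //= /co mxE.
  by move/eqP; rewrite oner_eq0.
exists (e2 + (pol a e2 / pol a e0) *: e0).
  apply/eqP => /(congr1 (fun v => co v 2)); rewrite coD coZ co0 // co2 //= /co mxE.
  by rewrite mulr0 addr0 => /eqP; rewrite oner_eq0.
rewrite /eform polDr polZr divfK // (addff two0) expr0n add0r.
by rewrite hypD hypZ f0 polZr /hyp /pol !co0 ?co2 //=; ring.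
Qed.

(** Adding s c1 to [u] keeps B(c1, u) = 1 and adds s to f_a(u), so s = f_a(u) makes the vector
    singular. *)
Lemma hyperbolic_pair a c1 : c1 != 0 -> eform a c1 = 0 ->
  exists2 c2, pol c1 c2 = 1 & eform a c2 = 0.
Proof.
move=> /pol_nondeg[u hu] f1; exists (u + eform a u *: c1).
  by rewrite !polE hu mulr0 addr0.
by rewrite eformD eformZ f1 polZr (polC u) hu mulr0 addr0 mulr1 (addff two0).
Qed.

(** The vectors of W of norm 1; by [adj3P] they parametrize the common neighbours of the triangle
    [a], [a + c1], [a + c2]. *)
Definition perp a c1 c2 v := [&& pol c1 v == 0, pol c2 v == 0 & eform a v == 1].

(** * Common neighbours of a non-linear triangle *)

Section Frame.
Context (a c1 c2 : V) (ea : ell a) (f1 : eform a c1 = 0) (f2 : eform a c2 = 0).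
Hypothesis h12 : pol c1 c2 = 1.

Lemma hpair_neq0 : c1 != 0.
Proof.
apply: contraTneq (oner_neq0 F) => e.
by rewrite -h12 e -(scale0r 0) polZl mul0r eqxx.
Qed.

(** A singular [v] orthogonal to [c1] is a multiple of [c1] by ellipticity, and B(c2, v) = 0 with
    B(c1, c2) = 1 makes the factor 0. *)
Lemma perp_anisotropic v : v != 0 -> pol c1 v = 0 -> pol c2 v = 0 -> eform a v != 0.
Proof.
move=> v0 h1 h2; apply/eqP=> fv; have [t e] := elimT (ellP _) ea _ _ f1 fv h1 hpair_neq0.
case/negP: v0; rewrite e; move: h2; rewrite e polZr polC h12 mulr1 => ->.
by rewrite scale0r.
Qed.

Lemma frame_ex : exists z w, hbasis c1 c2 z w /\ eform a z = 1.
Proof.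
have [z [z0 h1 h2]] := orth_ex c1 c2.
have fz := perp_anisotropic z0 h1 h2.
(* Every element of the field is a square, so [z] can be rescaled to norm 1. *)
have [r hr] := sqrt_ex two0 (eform a z).
have r0 : r != 0 by apply: contraNneq fz => e; rewrite -hr e expr0n.
have z'0 : r^-1 *: z != 0 by rewrite scaler_eq0 invr_eq0 (negbTE r0).
have [||w hw] := hbasis_complete two0 h12 z'0; rewrite ?polZr ?h1 ?h2 ?mulr0 //.
exists (r^-1 *: z), w; split=> //.
by rewrite eformZ -hr; field.
Qed.

(** The form takes the value t^2 + t + f_a(w) at t z + w, a nonzero vector of the anisotropic plane.
    Hence f_a(w) serves as the constant d of the overview. *)
Lemma frame_wp z w : hbasis c1 c2 z w -> eform a z = 1 -> forall t, wp t != eform a w.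
Proof.
move=> [_ hzw h1z h1w [h2z h2w]] fz t; rewrite -(addf_eq0 two0).
have -> : wp t + eform a w = eform a (t *: z + w).
  by rewrite eformD eformZ fz polZl hzw /wp; ring.
apply: perp_anisotropic; rewrite ?polE ?h1z ?h1w ?h2z ?h2w ?mulr0 ?addr0 //.
apply: contraTneq (oner_neq0 F) => /(congr1 (pol z)).
rewrite !polE mulr0 add0r hzw => ->.
by rewrite -(scale0r 0) polZr mul0r eqxx.
Qed.

Lemma perp_expand z w v : hbasis c1 c2 z w -> pol c1 v = 0 -> pol c2 v = 0 ->
  v = pol w v *: z + pol z v *: w.
Proof.
move=> hb h1 h2; rewrite {1}(hbasis_expand two0 hb v) h1 h2.
by rewrite !scale0r !add0r.
Qed.

(** Squaring is bijective, so each of the q + 1 one-dimensional subspaces of W contains exactly one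
    vector of norm 1. [option F] indexes them: [Some t] for the span of t z + w, [None] for that of
    [z]. *)
Lemma card_perp : #|[set v | perp a c1 c2 v]| = #|F|.+1.
Proof.
have [z [w [hb fz]]] := frame_ex; have hnz := frame_wp hb fz.
have [_ hzw h1z h1w [h2z h2w]] := hb.
have [g gK Kg] := injF_bij (sqr_inj two0).
pose r t := g (t ^+ 2 + t + eform a w).
have r0 t : r t != 0.
  apply: contraNneq (hnz t) => /(congr1 (fun u : F => u ^+ 2)).
  by rewrite /r Kg expr0n /= => /eqP; rewrite (addf_eq0 two0).
pose h o := if o is Some t then (r t)^-1 *: (t *: z + w) else z.
have hz t : pol z (h (Some t)) = (r t)^-1 by rewrite /= !polE hzw; ring.
have hw t : pol w (h (Some t)) = (r t)^-1 * t by rewrite /= !polE polC hzw; ring.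
have hinj : injective h.
  move=> [s|] [t|] // e.
  - have er : (r s)^-1 = (r t)^-1 by rewrite -!hz e.
    have := hw s; rewrite e hw er => /mulfI -> //.
    by rewrite invr_eq0.
  - by have /eqP := hz s; rewrite e (polxx two0) eq_sym invr_eq0 (negbTE (r0 s)).
  - by have /eqP := hz t; rewrite -e (polxx two0) eq_sym invr_eq0 (negbTE (r0 t)).
rewrite -[LHS](_ : #|h @: setT| = _); last first.
  congr #|pred_of_set _|; apply/setP => v; rewrite inE; apply/imsetP/idP.
    move=> [[t|] _ ->]; rewrite /perp /= ?polE ?h1z ?h1w ?h2z ?h2w ?fz ?eqxx //.
    rewrite !mulr0 addr0 mulr0 eqxx /= eformZ eformD eformZ fz polZl hzw.
    rewrite exprVn -(inj_eq (mulfI (_ : r t ^+ 2 != 0))) ?expf_neq0 // mulVKf ?expf_neq0 //.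
    by rewrite mulr1 /r Kg; apply/eqP; ring.
  move=> /and3P[/eqP h1 /eqP h2 /eqP fv].
  have ev := perp_expand hb h1 h2.
  move: ev fv; set s := pol w v; set t := pol z v => -> {h1 h2}.
  have [->|t0] := eqVneq t 0.
    rewrite scale0r addr0 eformZ fz mulr1 => s1.
    exists None => //=; have -> : s = 1 by apply: (sqr_inj two0); rewrite /= expr1n.
    by rewrite scale1r.
  rewrite eformD !eformZ fz polZl polZr hzw => e.
  exists (Some (s / t)) => //=.
  have -> : r (s / t) = t^-1.
    apply: (sqr_inj two0); rewrite /= /r Kg; apply: (mulfI (expf_neq0 2 t0)).
    by rewrite exprVn mulfV ?expf_neq0 // -e; field.
  by rewrite invrK scalerDr scalerA; congr (_ *: _ + _); field.
by rewrite card_imset // cardsT card_option.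
Qed.

(** Put e = c1 + c2 + v. Tangency with [a] makes e singular, and tangency with [a + c1] and [a + c2]
    puts B(c1, e) and B(c2, e) in {0, 1}. If B(c1, e) = 0, then e = t c1 with t = B(c2, e), so e is
    0 or [c1], both excluded; likewise for [c2]. Both values are thus 1, which means that [v] is
    orthogonal to [c1] and [c2], and then f_a(e) = f_a(v) + 1. *)
Lemma adj3P v :
  [&& adj a (a + c1 + c2 + v), adj (a + c1) (a + c1 + c2 + v)
    & adj (a + c2) (a + c1 + c2 + v)] = perp a c1 c2 v.
Proof.
have c20 : c2 != 0.
  by apply: contraTneq (oner_neq0 F) => e; rewrite -h12 e -(scale0r 0) polZr mul0r eqxx.
pose e := c1 + c2 + v; have -> : a + c1 + c2 + v = a + e by rewrite /e !addrA.
have p1 : pol c1 e = 1 + pol c1 v by rewrite !polE h12; ring.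
have p2 : pol c2 e = 1 + pol c2 v by rewrite !polE (polC c2) h12; ring.
have fe : eform a e = eform a v + 1 + (pol c1 v + pol c2 v).
  by rewrite /e !eformD f1 f2 h12 polDl; ring.
apply/and3P/and3P => [[/andP[e0 /eqP fe0]] | [/eqP h1 /eqP h2 /eqP fv]].
  rewrite addKK in fe0.
  rewrite !adj_cone // !wp_eq0 => /andP[n1 q1] /andP[n2 q2].
  have {}e0 : e != 0 by apply: contraNneq e0 => ->; rewrite addr0.
  have k1 : pol c1 e != 0.
    apply/eqP => z1; have [t et] := elimT (ellP _) ea _ _ f1 fe0 z1 hpair_neq0.
    move: q2; rewrite et polZr polC h12 mulr1 => /orP[]/eqP t1.
      by move: e0; rewrite et t1 scale0r eqxx.
    by move: n1; rewrite et t1 scale1r eqxx.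
  have k2 : pol c2 e != 0.
    apply/eqP => z1; have [t et] := elimT (ellP _) ea _ _ f2 fe0 z1 c20.
    move: q1; rewrite et polZr h12 mulr1 => /orP[]/eqP t1.
      by move: e0; rewrite et t1 scale0r eqxx.
    by move: n2; rewrite et t1 scale1r eqxx.
  move: q1 q2; rewrite (negbTE k1) (negbTE k2) /= p1 p2.
  rewrite -(addf_eq0 two0) addrAC (addff two0) add0r => v1.
  rewrite -(addf_eq0 two0) addrAC (addff two0) add0r => v2.
  split=> //; move: fe; rewrite (eqP v1) (eqP v2) !addr0 fe0 => /esym/eqP.
  by rewrite (addf_eq0 two0).
rewrite h1 in p1; rewrite h2 in p2; rewrite addr0 in p1; rewrite addr0 in p2.
have fe0 : eform a e = 0 by rewrite fe fv h1 h2 !addr0 (addff two0).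
have e0 : e != 0.
  by apply: contraTneq (oner_neq0 F) => ee; rewrite -p1 ee -(scale0r 0) polZr mul0r eqxx.
have n c : pol c e = 1 -> c != e.
  by move=> p; apply: contraTneq (oner_neq0 F) => ee; rewrite -p ee (polxx two0) eqxx.
rewrite !adj_cone // p1 p2 !n // wp_eq0 eqxx orbT; split=> //.
by rewrite /adj addKK fe0 eqxx andbT -subr_eq0 opprD addrA subrr sub0r oppr_eq0.
Qed.

(** The contributions of [c1] and [c2] to the pairing cancel, leaving B(z, v). The value 0 allowed
    by [adj_cone] does not occur for distinct vertices: it makes [v] a multiple of [z] of the same
    norm, hence [z] itself. *)
Lemma perp_adj z w v : hbasis c1 c2 z w -> eform a z = 1 -> perp a c1 c2 v ->
  adj (a + c1 + c2 + z) (a + c1 + c2 + v) = (pol z v == 1).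
Proof.
move=> hb fz /and3P[/eqP v1 /eqP v2 /eqP fv].
have [_ hzw z1 _ [z2 _]] := hb.
have cone u : pol c1 u = 0 -> pol c2 u = 0 -> eform a u = 1 -> eform a (c1 + c2 + u) = 0.
  move=> u1 u2 fu; rewrite !eformD f1 f2 fu h12 polDl u1 u2; ring: two0.
have E u : a + c1 + c2 + u = a + (c1 + c2 + u) by rewrite !addrA.
rewrite !E adj_cone ?cone //.
rewrite (inj_eq (addrI _)).
have -> : pol (c1 + c2 + z) (c1 + c2 + v) = pol z v.
  rewrite !polE v1 v2 (polC z c1) (polC z c2) z1 z2 h12 (polC c2 c1) h12; ring: two0.
rewrite wp_eq0; have [z0|_] := eqVneq (pol z v) 0.
  have := perp_expand hb v1 v2; rewrite z0 scale0r addr0 => ev.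
  have s1 : pol w v = 1.
    by apply: (sqr_inj two0); rewrite /= expr1n -fv [in RHS]ev eformZ fz mulr1.
  by rewrite [in LHS]ev s1 scale1r eqxx /= eq_sym oner_eq0.
have [p1|//] := eqVneq (pol z v) 1; last by rewrite andbF.
rewrite andbT; apply: contraTneq (oner_neq0 F) => e.
by rewrite -p1 -e (polxx two0) eqxx.
Qed.

(** B(z, v) = 1 says that [v] has [w]-coordinate 1, and norm 1 becomes s^2 + s + f_a(w) = 1. *)
Lemma perp_adjP z w v : hbasis c1 c2 z w -> eform a z = 1 ->
  reflect (exists2 s, v = s *: z + w & wp s = eform a w + 1)
          (perp a c1 c2 v && adj (a + c1 + c2 + z) (a + c1 + c2 + v)).
Proof.
move=> hb fz; have [_ hzw z1 w1 [z2 w2]] := hb.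
apply: (iffP andP) => [[pv]|[s -> hs]].
  rewrite (perp_adj hb) // => /eqP zv; have /and3P[/eqP v1 /eqP v2 /eqP fv] := pv.
  have ev := perp_expand hb v1 v2; rewrite zv scale1r in ev.
  exists (pol w v) => //; move: fv; rewrite [in LHS]ev eformD eformZ fz polZl hzw /wp => <-.
  by ring: two0.
have pv : perp a c1 c2 (s *: z + w).
  rewrite /perp !polE z1 z2 w1 w2 !mulr0 addr0 eqxx /= eformD eformZ fz polZl hzw !mulr1.
  by rewrite addrAC -/(wp s) hs addrAC (addff two0) add0r.
by rewrite (perp_adj hb) // !polE hzw mulr0 add0r.
Qed.
End Frame.

End Tangency.

(** * Elliptic ovoids as the sets attached to elliptic vectors *)

Section Ovoids.
Local Open Scope ring_scope.
Context (F : finFieldType) (two0 : 2%:R = 0 :> F).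
Local Notation V := 'rV[F]_4.
Implicit Types (a b c d p x y z w : V) (u v : 'rV[F]_5) (s t : F).
Let polE := (polDl, polDr, polZl, polZr, polxx two0).

(** Projection from the nucleus; [lft a] inverts it on the solid x0 = B(a, x). *)
Definition tl v : V := \row_(i < 4) v ord0 (lift ord0 i).
Definition lft a x : 'rV[F]_5 :=
  \row_(i < 5) if unlift ord0 i is Some j then x ord0 j else pol a x.

Lemma cf0E v : cf 0 v = v ord0 ord0.
Proof. by congr (v _ _); apply/val_inj; rewrite /= inordK. Qed.

Lemma cfS v k : (k < 4)%N -> cf k.+1 v = co (tl v) k.
Proof.
by move=> hk; rewrite /co mxE; congr (v _ _); apply/val_inj; rewrite /= /bump !inordK.
Qed.

Lemma Qform_tl v : Qform v = cf 0 v ^+ 2 + hyp (tl v).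
Proof. by rewrite /Qform /hyp !cfS //; ring. Qed.

Lemma tlD u v : tl (u + v) = tl u + tl v.
Proof. by apply/rowP => i; rewrite !mxE. Qed.

Lemma tlZ t v : tl (t *: v) = t *: tl v.
Proof. by apply/rowP => i; rewrite !mxE. Qed.

Lemma cf0Z t v : cf 0 (t *: v) = t * cf 0 v.
Proof. by rewrite /cf mxE. Qed.

Lemma cf0D u v : cf 0 (u + v) = cf 0 u + cf 0 v.
Proof. by rewrite /cf mxE. Qed.

Lemma tl_inj u v : cf 0 u = cf 0 v -> tl u = tl v -> u = v.
Proof.
rewrite !cf0E => h0 /rowP ht; apply/rowP => i.
by case: (unliftP ord0 i) => [j|] -> //; have := ht j; rewrite !mxE.
Qed.

Lemma tl_lft a x : tl (lft a x) = x.
Proof. by apply/rowP => i; rewrite !mxE liftK. Qed.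

Lemma cf0_lft a x : cf 0 (lft a x) = pol a x.
Proof. by rewrite cf0E mxE unlift_none. Qed.

Lemma lft_tl a v : cf 0 v = pol a (tl v) -> v = lft a (tl v).
Proof. by move=> h; apply: tl_inj; rewrite ?cf0_lft ?tl_lft. Qed.

Lemma lftD a x y : lft a (x + y) = lft a x + lft a y.
Proof. by apply: tl_inj; rewrite ?cf0D ?cf0_lft ?polDr // tlD !tl_lft. Qed.

Lemma lftZ a t x : lft a (t *: x) = t *: lft a x.
Proof. by apply: tl_inj; rewrite ?cf0Z ?cf0_lft ?polZr // tlZ !tl_lft. Qed.

Lemma lft_neq0 a x : x != 0 -> lft a x != 0.
Proof.
apply: contraNneq => e; rewrite -(tl_lft a x) e.
by apply/eqP/rowP => i; rewrite !mxE.
Qed.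

Lemma Qform_lft a x : Qform (lft a x) = eform a x.
Proof. by rewrite Qform_tl cf0_lft tl_lft. Qed.

Lemma point_neq0 v : is_point v -> v != 0.
Proof.
case/existsP=> i /andP[/eqP vi _]; apply: contraTneq (oner_neq0 F) => e.
by rewrite -vi e mxE eqxx.
Qed.

Lemma point_scale v t : is_point v -> is_point (t *: v) -> t = 1.
Proof.
move=> pv ptv; have tv0 := point_neq0 ptv.
case/existsP: pv => i /andP[/eqP vi /forallP hi].
case/existsP: ptv => j /andP[/eqP vj /forallP hj].
have t0 : t != 0 by apply: contraNneq tv0 => ->; rewrite scale0r.
have [ij|ji|/val_inj ij] := ltngtP i j.
- have := hj i; rewrite ij /= mxE vi mulr1 => /eqP t00.
  by rewrite t00 eqxx in t0.
- have := hi j; rewrite ji /= => /eqP vj0.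
  by move: vj; rewrite mxE vj0 mulr0 => /esym/eqP; rewrite oner_eq0.
- by move: vj; rewrite -ij mxE vi mulr1.
Qed.

Lemma point_ex v : v != 0 -> exists2 t, t != 0 & is_point (t *: v).
Proof.
move=> v0; have [i0 hi0] : exists i, v ord0 i != 0.
  apply/existsP; apply: contraNT v0; rewrite negb_exists => /forallP h.
  by apply/eqP/rowP => i; rewrite mxE; apply/eqP; rewrite -[_ == _]negbK.
case: (@arg_minnP _ i0 (fun i => v ord0 i != 0) (fun i : 'I_5 => val i) hi0) => i vi hmin.
exists (v ord0 i)^-1; first by rewrite invr_eq0.
apply/existsP; exists i; rewrite mxE mulVf // eqxx /=.
apply/forallP => j; apply/implyP => ji; rewrite mxE mulf_eq0.
apply/orP; right; apply: contraTT ji => vj; rewrite -leqNgt.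
exact: hmin.
Qed.

(** The representative, in the sense of [is_point], of the projective point spanned by [v]; the
    default 0 is reached only for [v = 0]. *)
Definition normalize v := odflt 0 [pick w | is_point w & [exists t, w == t *: v]].

Lemma normalizeP v : v != 0 ->
  is_point (normalize v) /\ exists2 t, t != 0 & normalize v = t *: v.
Proof.
move=> v0; rewrite /normalize; case: pickP => [w /andP[pw /existsP[t /eqP e]]|/= h].
  split=> //; exists t => //; apply: contraNneq (point_neq0 pw) => t0.
  by rewrite e t0 scale0r.
have [t _ pt] := point_ex v0; have := h (t *: v).
by rewrite pt /=; move/negbT; rewrite negb_exists => /forallP/(_ t); rewrite eqxx.
Qed.

Lemma normalize_uniq v (w : 'rV[F]_5) t : is_point w -> w = t *: v -> w = normalize v.
Proof.
move=> pw e; have w0 := point_neq0 pw.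
have v0 : v != 0 by apply: contraNneq w0 => v0; rewrite e v0 scaler0.
have t0 : t != 0 by apply: contraNneq w0 => t0; rewrite e t0 scale0r.
have [pn [s s0 es]] := normalizeP v0.
have en : normalize v = (s / t) *: w by rewrite es e scalerA divfK.
have st : s / t = 1 by apply: (point_scale pw); rewrite -en.
by rewrite en st scale1r.
Qed.

Lemma normalizeZ v t : v != 0 -> t != 0 -> normalize (t *: v) = normalize v.
Proof.
move=> v0 t0; have tv0 : t *: v != 0 by rewrite scaler_eq0 negb_or t0.
have [pn [s s0 es]] := normalizeP tv0.
by apply: (@normalize_uniq _ _ (s * t)) => //; rewrite es scalerA.
Qed.

Definition ov a : {set 'rV[F]_5} := [set v in Q0 F | cf 0 v == pol a (tl v)].

Lemma in_ov a v :
  (v \in ov a) = [&& is_point v, cf 0 v == pol a (tl v) & eform a (tl v) == 0].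
Proof.
rewrite !inE -andbA; congr (_ && _); rewrite andbC.
by case: eqP => //= h; rewrite Qform_tl h.
Qed.

Lemma ov_lift a x : x != 0 -> eform a x = 0 -> normalize (lft a x) \in ov a.
Proof.
move=> x0 fx; have [pn [t t0 e]] := normalizeP (lft_neq0 a x0).
rewrite in_ov pn e -lftZ cf0_lft tl_lft eqxx.
by rewrite eformZ fx mulr0 eqxx.
Qed.

(** The solids of [a] and [b] meet over the hyperplane orthogonal to [a + b], where forms and lifts
    agree. *)
Lemma ov_pol0 a b x : pol (a + b) x = 0 -> eform b x = eform a x /\ lft b x = lft a x.
Proof.
move=> h; have e : pol a x = pol b x.
  by apply/eqP; rewrite -(addf_eq0 two0) -polDl h.
by rewrite /eform e; split=> //; apply: tl_inj; rewrite ?cf0_lft ?tl_lft.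
Qed.

(** A common point projects to a singular vector orthogonal to the singular vector [a + b], so
    ellipticity makes the two proportional. *)
Lemma ov_tangent a b : ell a -> adj a b ->
  ov a :&: ov b = [set normalize (lft a (a + b))].
Proof.
move=> ea ab; have /andP[nab /eqP fab] := ab.
have ab0 : a + b != 0 by rewrite (add_eq0 two0).
have [fb lb] := ov_pol0 (polxx two0 (a + b)).
apply/setP => v; rewrite inE in_set1; apply/andP/eqP => [[]|->]; last first.
  by split; [|rewrite -lb]; apply: ov_lift; rewrite ?fb.
rewrite !in_ov => /and3P[pv /eqP va /eqP fv] /and3P[_ /eqP vb _].
have p0 : pol (a + b) (tl v) = 0 by rewrite polDl -va -vb (addff two0).
have [t et] := elimT (ellP _) ea _ _ fab fv p0 ab0.
apply: (@normalize_uniq _ _ t) => //.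
by rewrite (lft_tl va) et lftZ.
Qed.

(** When c = a + b is not singular, every x orthogonal to c becomes singular after adding a multiple
    of c, because f_a(x + t c) = f_a(x) + t^2 f_a(c) and square roots exist. Starting from [z] and
    [w], independent modulo c, this gives two common points. *)
Lemma ov_secant a b : a != b -> eform a (a + b) != 0 -> #|ov a :&: ov b| != 1%N.
Proof.
move=> nab fab; have [c ec] : exists c, c = a + b by exists (a + b).
rewrite -ec in fab.
have c0 : c != 0 by rewrite ec (add_eq0 two0).
have [c2 h] := pol_nondeg c0.
have [z [z0 cz c2z]] := orth_ex c c2.
have [w [_ hzw _ cw _]] := hbasis_complete two0 h z0 cz c2z.
have pt x : pol c x = 0 -> pol c x = 0 /\ exists t, eform a (x + t *: c) = 0.
  move=> cx; split=> //; have [t ht] := sqrt_ex two0 (eform a x / eform a c).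
  exists t; rewrite (eformD two0) eformZ polZr (polC x) cx mulr0 addr0 ht divfK //.
  exact: addff.
have [_ [s hs]] := pt z cz; have [_ [t ht]] := pt w cw.
set x := z + s *: c in hs; set y := w + t *: c in ht.
have cx : pol c x = 0 by rewrite !polE cz mulr0 addr0.
have cy : pol c y = 0 by rewrite !polE cw mulr0 addr0.
have zx : pol z x = 0 by rewrite !polE (polC z c) cz; ring.
have zy : pol z y = 1 by rewrite !polE hzw (polC z c) cz; ring.
have wx : pol w x = 1 by rewrite !polE (polC w z) hzw (polC w c) cw; ring.
have x0 : x != 0.
  by apply: contraTneq (oner_neq0 F) => e; rewrite -wx e -(scale0r 0) polZr mul0r eqxx.
have y0 : y != 0.
  by apply: contraTneq (oner_neq0 F) => e; rewrite -zy e -(scale0r 0) polZr mul0r eqxx.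
have mem q : q != 0 -> eform a q = 0 -> pol c q = 0 ->
    normalize (lft a q) \in ov a :&: ov b.
  move=> q0 fq; rewrite ec => /ov_pol0[fb lb].
  by rewrite inE ov_lift //= -lb ov_lift // fb.
apply/negP => /cards1P[v ev].
have := mem y y0 ht cy; have := mem x x0 hs cx; rewrite ev !inE => /eqP ex /eqP ey.
have [_ [r r0 er]] := normalizeP (lft_neq0 a x0).
have [_ [r' r'0 er']] := normalizeP (lft_neq0 a y0).
(* The points differ because B(z, x) = 0 while B(z, y) = 1. *)
have : tl (r *: lft a x) = tl (r' *: lft a y) by rewrite -er -er' ex ey.
rewrite !tlZ !tl_lft => /(congr1 (pol z)); rewrite !polZr zx zy mulr0 mulr1.
by move/esym/eqP; rewrite (negbTE r'0).
Qed.

Lemma tangentE a b : ell a -> a != b -> (#|ov a :&: ov b| == 1%N) = adj a b.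
Proof.
move=> ea ab; apply/idP/idP => [h|h]; last by rewrite ov_tangent // cards1.
by rewrite /adj ab /=; apply: contraTT h; exact: ov_secant.
Qed.

(** The vector [a + b] is orthogonal to every vector singular for f_a, and these span F^4: besides
    [c1] and [c2] they include c1 + f_a(x) c2 + x for each x in W. *)
Lemma ov_inj a b : ell a -> ov a = ov b -> a = b.
Proof.
move=> ea e; apply/eqP; rewrite -(add_eq0 two0); apply/eqP/pol_eq0.
have [g eg] : exists g, g = a + b by exists (a + b).
rewrite -eg.
have sing x : eform a x = 0 -> pol g x = 0.
  move=> fx; have [->|x0] := eqVneq x 0; first by rewrite -(scale0r 0) polZr mul0r.
  have [pn [t t0 et]] := normalizeP (lft_neq0 a x0).
  have : normalize (lft a x) \in ov b by rewrite -e ov_lift.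
  rewrite in_ov et tlZ tl_lft cf0Z cf0_lft => /and3P[_ + _].
  by rewrite polZr (inj_eq (mulfI t0)) -(addf_eq0 two0) -polDl -eg => /eqP.
have [c1 c10 f1] := isotropic_ex two0 a.
have [c2 h12 f2] := hyperbolic_pair two0 c10 f1.
have [z [w [hb fz]]] := frame_ex two0 ea f1 h12.
have perp0 x : pol c1 x = 0 -> pol c2 x = 0 -> pol g x = 0.
  move=> h1 h2; have := sing (c1 + eform a x *: c2 + x).
  rewrite !polE (sing _ f1) (sing _ f2) mulr0 !add0r; apply.
  rewrite !(eformD two0) eformZ f1 f2 polDl !polZl polZr h12 h1 h2.
  by ring: two0.
have [_ _ z1 w1 [z2 w2]] := hb.
move=> x; rewrite (hbasis_expand two0 hb x) !polE (sing _ f1) (sing _ f2).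
by rewrite !perp0 // !mulr0 !addr0.
Qed.

(** The vector whose form f_a is the normal form [ell_form] with d = t^2; every d is such a
    square. *)
Definition ell_vec t : V := \row_(i < 4) nth 0 [:: t; 1] i.

Lemma ell_formE t w : ell_form (t ^+ 2) w = eform (ell_vec t) w.
Proof. by rewrite /ell_form /eform /pol /hyp /ell_vec /co !mxE !inordK //=; ring: two0. Qed.

Lemma irreducible_wp (d : F) :
  irreducible_poly ('X^2 + 'X + d%:P) <-> forall t, wp t != d.
Proof.
have sz : size ('X^2 + 'X + d%:P : {poly F}) = 3.
  rewrite -addrA size_polyDl size_polyXn // (leq_ltn_trans (size_polyD _ _)) //.
  by rewrite size_polyX gtn_max /= (leq_ltn_trans (size_polyC_leq1 _)).
have rt t : root ('X^2 + 'X + d%:P) t = (wp t == d).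
  by rewrite /root !hornerE /wp -(addf_eq0 two0).
split=> [[_ irr] t|h].
  apply/negP; rewrite -rt -dvdp_XsubCl => /irr.
  by rewrite size_XsubC => /(_ isT)/eqp_size; rewrite size_XsubC sz.
by apply: cubic_irreducible; rewrite ?sz // => t; rewrite rt.
Qed.

(** The first two coordinates carry an anisotropic binary form, so a singular vector with
    [co x 2 = 0] is a multiple of the last basis vector. If [co x 2] is nonzero, subtracting a
    multiple of [x] from [y] clears that coordinate of [y], and orthogonality to [x] kills what is
    left. *)
Lemma ell_vec_ell t : (forall s, wp s != t ^+ 2) -> ell (ell_vec t).
Proof.
move=> ht.
have fE x : eform (ell_vec t) x =
    co x 0 ^+ 2 + co x 0 * co x 1 + t ^+ 2 * co x 1 ^+ 2 + co x 2 * co x 3.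
  by rewrite -ell_formE.
have aniso (r s : F) : r ^+ 2 + r * s + t ^+ 2 * s ^+ 2 = 0 -> r = 0 /\ s = 0.
  have [-> e|s0 e] := eqVneq s 0.
    by split=> //; apply/eqP; rewrite -sqrf_eq0 -e; apply/eqP; ring.
  case/eqP: (ht (r / s)); apply/eqP; rewrite -(addf_eq0 two0).
  have -> : wp (r / s) + t ^+ 2 = (r ^+ 2 + r * s + t ^+ 2 * s ^+ 2) / s ^+ 2.
    by rewrite /wp; field.
  by rewrite e mul0r.
have co0 k : co (0 : V) k = 0 by rewrite /co mxE.
have xP x : co x 0 = 0 -> co x 1 = 0 -> co x 2 = 0 -> co x 3 = 0 -> x = 0.
  by move=> h0 h1 h2 h3; apply: co_inj => -[|[|[|[|k]]]] //= _; rewrite co0.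
apply/ellP => x y fx fy xy x0; have [x2|x2] := eqVneq (co x 2) 0.
  have [x00 x1] : co x 0 = 0 /\ co x 1 = 0.
    by apply: aniso; rewrite -[RHS]fx fE x2; ring.
  have x3 : co x 3 != 0 by apply: contraNneq x0 => x3; apply/eqP/xP.
  have y2 : co y 2 = 0.
    apply: (mulfI x3); rewrite mulr0 -[RHS]xy /pol x00 x1 x2; ring.
  have [y0 y1] : co y 0 = 0 /\ co y 1 = 0.
    by apply: aniso; rewrite -[RHS]fy fE y2; ring.
  exists (co y 3 / co x 3); apply: co_inj => -[|[|[|[|k]]]] //= _; rewrite coZ.
  - by rewrite x00 y0 mulr0.
  - by rewrite x1 y1 mulr0.
  - by rewrite x2 y2 mulr0.
  - by rewrite divfK.
exists (co y 2 / co x 2); set r := _ / _.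
apply/eqP; rewrite -(add_eq0 two0); apply/eqP; set v := y + _.
have v2 : co v 2 = 0 by rewrite coD coZ divfK // (addff two0).
have fv : eform (ell_vec t) v = 0.
  by rewrite (eformD two0) eformZ fx fy polZr polC xy; ring.
have [v0 v1] : co v 0 = 0 /\ co v 1 = 0.
  by apply: aniso; rewrite -[RHS]fv fE v2; ring.
apply: xP => //; apply: (mulfI x2).
have : pol x v = 0 by rewrite !polE xy; ring.
by rewrite /pol v0 v1 v2 !mulr0 !add0r addr0.
Qed.

Lemma ell_ex : exists a, ell a.
Proof.
have [d hd] := wp_nonsurj two0; have [e he] := sqrt_ex two0 d.
by exists (ell_vec e); apply: ell_vec_ell; rewrite he.
Qed.

Lemma riesz (M : 'M[F]_(4, 1)) : exists a, forall x, (x *m M) ord0 ord0 = pol a x.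
Proof.
pose m k := M (inord k) ord0.
exists (\row_(i < 4) nth 0 [:: m 1; m 0; m 3; m 2]%N i) => x.
rewrite mxE /pol /co !mxE !inordK //= /m.
rewrite !big_ord_recl big_ord0 addr0.
have e0 : ord0 = inord 0 :> 'I_4 by apply: val_inj; rewrite /= inordK.
have e1 : lift ord0 ord0 = inord 1 :> 'I_4 by apply: val_inj; rewrite /= inordK.
have e2 : lift ord0 (lift ord0 ord0) = inord 2 :> 'I_4.
  by apply: val_inj; rewrite /= inordK.
have e3 : lift ord0 (lift ord0 (lift ord0 ord0)) = inord 3 :> 'I_4.
  by apply: val_inj; rewrite /= inordK.
by rewrite e3 e2 e1 e0; ring.
Qed.

(** An elliptic solid misses the nucleus, so it is the graph of a linear functional B(a, .) over the
    last four coordinates. Conversely, a symplectic basis with f_a(z) = 1 puts f_a in normal form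
    with d = f_a(w). *)
Lemma elliptic_ovoidP (X : {set 'rV[F]_5}) :
  elliptic_ovoid X <-> exists2 a, ell a & X = ov a.
Proof.
split=> [[M [rM [c [d [c0 /irreducible_wp hd hM]]] ->]]|[a ea ->]].
  have [r er] := sqrt_ex two0 d; rewrite -er in hd hM.
  have er' := ell_vec_ell hd.
  pose N : 'M[F]_4 := colsub (lift ord0) M.
  have tlM w : tl (w *m M) = w *m N.
    by apply/rowP => i; rewrite !mxE; apply: eq_bigr => j _; rewrite !mxE.
  have hyM x : Qform (x *m M) = c * eform (ell_vec r) x.
    by rewrite hM ell_formE.
  have polN x w : pol (x *m N) (w *m N) = c * pol x w.
    have := hM (x + w); rewrite mulmxDl Qform_tl tlD cf0D hypD !tlM ell_formE (eformD two0).
    rewrite mulrDr [c * (_ + eform _ _)]mulrDr -!hyM !Qform_tl !tlM => e.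
    apply: (addrI (cf 0 (x *m M) ^+ 2 + hyp (x *m N) + (cf 0 (w *m M) ^+ 2 + hyp (w *m N)))).
    by rewrite -e; ring: two0.
  (* A vector killed by [N] lies in the radical of the nondegenerate form c B. *)
  have uN : N \in unitmx.
    rewrite -row_free_unit -kermx_eq0; apply/negPn/negP => /rowV0Pn[x /sub_kermxP xN x0].
    case/negP: x0; apply/eqP/pol_eq0 => w; apply: (mulfI c0).
    by rewrite mulr0 -polN xN -(scale0r 0) polZl mul0r.
  have [a ha] := riesz (invmx N *m col ord0 M).
  have cfM w : cf 0 (w *m M) = pol a (w *m N).
    rewrite -ha mulmxA mulmxK // cf0E !mxE; apply: eq_bigr => i _; by rewrite !mxE.
  have fN w : eform a (w *m N) = c * eform (ell_vec r) w.
    by rewrite -ell_formE -hM Qform_tl tlM cfM.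
  exists a.
    apply/ellP => x y; rewrite -(mulmxKV uN x) -(mulmxKV uN y).
    set x' := x *m _; set y' := y *m _; rewrite !fN polN => hx hy hxy x0.
    have z0 t : c * t = 0 -> t = 0 by move/eqP; rewrite mulf_eq0 (negbTE c0) => /eqP.
    have x'0 : x' != 0 by apply: contraNneq x0 => ->; rewrite mul0mx.
    have [t ->] := elimT (ellP _) er' _ _ (z0 _ hx) (z0 _ hy) (z0 _ hxy) x'0.
    by exists t; rewrite -scalemxAl.
  apply/setP => v; rewrite !inE; congr (_ && _).
  apply/submxP/eqP => [[w ->]|va]; first by rewrite cfM tlM.
  exists (tl v *m invmx N); apply: tl_inj; last by rewrite tlM mulmxKV.
  by rewrite cfM mulmxKV.
have [c1 c10 f1] := isotropic_ex two0 a.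
have [c2 h12 f2] := hyperbolic_pair two0 c10 f1.
have [z [w [hb fz]]] := frame_ex two0 ea f1 h12.
have [_ hzw z1 w1 [z2 w2]] := hb.
(* The order matches [ell_form]: first the anisotropic plane, then the hyperbolic pair. *)
pose M : 'M[F]_(4, 5) := \matrix_(i < 4) lft a (nth 0 [:: z; w; c1; c2] i).
pose comb (u : V) := co u 0 *: z + co u 1 *: w + co u 2 *: c1 + co u 3 *: c2.
have uM (u : V) : u *m M = lft a (comb u).
  rewrite mulmx_sum_row !big_ord_recl big_ord0 addr0 /comb !lftD !lftZ !rowK /= !addrA /co.
  by congr (_ *: _ + _ *: _ + _ *: _ + _ *: _); congr (u _ _); apply: val_inj; rewrite /= inordK.
have combK x : x = comb (\row_(i < 4) nth 0 [:: pol w x; pol z x; pol c2 x; pol c1 x] i).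
  rewrite {1}(hbasis_expand two0 hb x) /comb /co !mxE !inordK //=.
  by rewrite -[RHS]addrA [RHS]addrC !addrA.
exists M; split.
- apply/eqP; rewrite -[_ == _]/(row_free M) -kermx_eq0; apply/negPn/negP.
  move=> /rowV0Pn[u /sub_kermxP e u0]; case/negP: u0.
  have cu : comb u = 0.
    by rewrite -(tl_lft a (comb u)) -uM e; apply/rowP => i; rewrite !mxE.
  have p0 x : pol x (comb u) = 0 by rewrite cu -(scale0r 0) polZr mul0r.
  apply/eqP/co_inj => -[|[|[|[|k]]]] //= _; rewrite [in RHS]/co mxE.
  + by rewrite -[RHS](p0 w) /comb !polE (polC w z) (polC w c1) (polC w c2) hzw w1 w2; ring.
  + by rewrite -[RHS](p0 z) /comb !polE (polC z c1) (polC z c2) hzw z1 z2; ring.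
  + by rewrite -[RHS](p0 c2) /comb !polE (polC c2 c1) h12 z2 w2; ring.
  + by rewrite -[RHS](p0 c1) /comb !polE h12 z1 w1; ring.
- exists 1, (eform a w); split; first exact: oner_neq0.
    by apply/irreducible_wp; exact: (frame_wp two0 ea f1 h12 hb fz).
  move=> u; rewrite uM Qform_lft mul1r /comb !(eformD two0) !eformZ f1 f2 fz /ell_form.
  rewrite !polE hzw (polC z c1) (polC z c2) (polC w c1) (polC w c2) z1 z2 w1 w2 h12 /co.
  ring.
- apply/setP => v; rewrite !inE; congr (_ && _).
  apply/eqP/submxP => [va|[u ->]]; last by rewrite uM cf0_lft tl_lft.
  by exists (\row_(i < 4) nth 0 [:: pol w (tl v); pol z (tl v); pol c2 (tl v); pol c1 (tl v)] i);
    rewrite uM -combK; exact: lft_tl.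
Qed.

(** Any two of these vectors differ by a nonzero multiple of [p], and [p] has the same lift to all
    the solids since B(p, p) = 0; all tangencies thus occur at one point. *)
Lemma rosette_line a p : ell a -> p != 0 -> eform a p = 0 ->
  rosette [set ov (a + t *: p) | t : F].
Proof.
move=> ea p0 fp.
have ft t : eform a (t *: p) = 0 by rewrite eformZ fp mulr0.
have et t : ell (a + t *: p) by exact: ell_translate.
have pt s : lft (a + s *: p) p = lft a p.
  by apply: tl_inj; rewrite ?tl_lft // !cf0_lft !polE mulr0 addr0.
have [pn _] := normalizeP (lft_neq0 a p0).
have := ov_lift p0 fp; rewrite !inE => /andP[nQ _].
have inj : injective (fun t => ov (a + t *: p)).
  move=> s t /(ov_inj (et s)) /addrI /eqP.
  by rewrite -subr_eq0 -scalerBl scaler_eq0 (negbTE p0) orbF subr_eq0 => /eqP.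
exists (normalize (lft a p)); split.
- by rewrite inE.
- by rewrite card_imset // cardsT.
- by move=> _ /imsetP[t _ ->]; apply/elliptic_ovoidP; exists (a + t *: p).
move=> _ _ /imsetP[s _ ->] /imsetP[t _ ->] nst.
have {}nst : s != t by apply: contraNneq nst => ->.
have ad : adj (a + s *: p) (a + t *: p).
  rewrite (adj_cone two0) // !polE !mulr0 (wp_eq0 two0) eqxx andbT.
  by rewrite -subr_eq0 -scalerBl scaler_eq0 (negbTE p0) orbF subr_eq0.
rewrite (ov_tangent (et s) ad) addrACA (addrr0 two0) add0r -scalerDl lftZ pt.
by rewrite normalizeZ ?lft_neq0 // (addf_eq0 two0).
Qed.

End Ovoids.

(** * Cliques of vectors and their common neighbours *)

Section Cliques.
Local Open Scope ring_scope.
Context (F : finFieldType) (two0 : 2%:R = 0 :> F).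
Local Notation V := 'rV[F]_4.
Implicit Types (a b c d p x y z w : V) (s t : F) (A : {set V}).
Let polE := (polDl, polDr, polZl, polZr, polxx two0).

Definition adj_clique A :=
  (forall a, a \in A -> ell a) /\
  (forall a b, a \in A -> b \in A -> a != b -> adj a b).

(** An affine line with singular direction; by [on_line_rosette] such sets give linear cliques. *)
Definition on_line A :=
  exists a p, [/\ ell a, p != 0, eform a p = 0 &
                  forall x, x \in A -> exists t, x = a + t *: p].

Definition nbrs A := [set d | [forall (a | a \in A), adj a d]].

Lemma nbrsP A d : reflect (forall a, a \in A -> adj a d) (d \in nbrs A).
Proof. by rewrite inE; apply: (iffP forall_inP). Qed.

Lemma adj_form a b : adj a b -> eform a (a + b) = 0.
Proof. by case/andP=> _ /eqP. Qed.

Lemma pol_singular a x y : ell a -> eform a x = 0 -> eform a y = 0 -> x != 0 ->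
  pol x y = 0 -> exists t, y = t *: x.
Proof. by move=> ea fx fy x0 xy; exact: (elimT (ellP a) ea). Qed.

Lemma adj_neq0 a b : adj a b -> a + b != 0.
Proof. by case/andP=> ab _; rewrite (add_eq0 two0). Qed.

Lemma adj_irr a : adj a a = false.
Proof. by rewrite /adj eqxx. Qed.

Lemma triangle_pol a b c : adj a b -> adj a c -> adj b c ->
  (pol (a + b) (a + c) == 0) || (pol (a + b) (a + c) == 1).
Proof.
move=> ab ac bc; rewrite -(wp_eq0 two0).
have := adj_cone two0 (adj_form ab) (adj_form ac).
by rewrite !(addKK two0) bc => /esym/andP[].
Qed.

(** If the pairing were 0, then [a], [b], [c] would lie on a line with singular direction, with a +
    c = t (a + b) and t neither 0 nor 1. A further vertex x off this line has B(a + b, a + x) = 1,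
    so B(a + c, a + x) = t, which is not an admissible value. All of [A] would then be on the
    line. *)
Lemma noncollinear A a b c : adj_clique A -> ~ on_line A ->
  a \in A -> b \in A -> c \in A -> a != b -> a != c -> b != c ->
  pol (a + b) (a + c) = 1.
Proof.
move=> [eA hA] nl aA bA cA ab ac bc.
have /orP[/eqP z0|/eqP //] := triangle_pol (hA _ _ aA bA ab) (hA _ _ aA cA ac) (hA _ _ bA cA bc).
have ab' := hA _ _ aA bA ab; have ac' := hA _ _ aA cA ac.
have ea := eA _ aA.
have [t et] := pol_singular ea (adj_form ab') (adj_form ac') (adj_neq0 ab') z0.
case: nl; exists a, (a + b); split=> //; [exact: adj_neq0 | exact: adj_form |].
have line x s : a + x = s *: (a + b) -> x = a + s *: (a + b).
  by move=> <-; rewrite (addKK two0).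
move=> x xA; have [->|ax] := eqVneq a x; first by exists 0; rewrite scale0r addr0.
have ax' := hA _ _ aA xA ax.
have [bx|bx] := eqVneq b x.
  by exists 1; rewrite scale1r (addKK two0).
have /orP[/eqP x0|/eqP x1] := triangle_pol ab' ax' (hA _ _ bA xA bx).
  have [s es] := pol_singular ea (adj_form ab') (adj_form ax') (adj_neq0 ab') x0.
  by exists s; exact: line.
have [cx|cx] := eqVneq c x; first by exists t; rewrite -cx; exact: line.
have := triangle_pol ac' ax' (hA _ _ cA xA cx).
rewrite et polZl x1 mulr1 => /orP[]/eqP e; rewrite e in et.
  by move: (adj_neq0 ac'); rewrite et scale0r eqxx.
by move: bc; rewrite -(addKK two0 a c) et scale1r (addKK two0) eqxx.
Qed.

Lemma card_nbrs3 a b c : ell a -> adj a b -> adj a c -> pol (a + b) (a + c) = 1 ->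
  #|nbrs [set a; b; c]| = #|F|.+1.
Proof.
move=> ea ab ac h.
rewrite -(card_perp two0 ea (adj_form ab) h).
have inj : injective (fun v => a + (a + b) + (a + c) + v) by move=> ? ? /addrI.
rewrite -[RHS](card_imset _ inj); congr #|pred_of_set _|; apply/setP => d.
have tr v := adj3P two0 ea (adj_form ab) (adj_form ac) h v.
apply/nbrsP/imsetP => [hd|[v]].
  exists (a + (a + b) + (a + c) + d); last by rewrite (addKK two0).
  rewrite inE -tr !(addKK two0) !hd //; by rewrite !inE eqxx ?orbT.
rewrite inE -tr !(addKK two0) => /and3P[h1 h2 h3] -> x.
by rewrite !inE => /orP[/orP[]|] /eqP ->.
Qed.

(** By [perp_adjP] the common neighbours correspond to the solutions of [wp s = eform a w + 1],
    where [eform a w] is not a value of [wp]. If 1 is a value, additivity excludes any solution; if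
    not, [wp_index2] gives one, and the solutions are s and s + 1. *)
Lemma nbrs4 a b c d : ell a -> adj a b -> adj a c -> pol (a + b) (a + c) = 1 ->
  d \in nbrs [set a; b; c] ->
  ((exists t : F, wp t = 1) -> nbrs [set a; b; c; d] = set0) /\
  ((forall t : F, wp t != 1) ->
     exists e e', adj e e' /\ nbrs [set a; b; c; d] = [set e; e']).
Proof.
move=> ea ab ac h dN.
have f1 := adj_form ab; have f2 := adj_form ac.
have tr v := adj3P two0 ea f1 f2 h v.
set u := a + (a + b) + (a + c) in tr; pose z := u + d.
have ez : u + z = d by rewrite /z (addKK two0).
clearbody z.
have pz : perp a (a + b) (a + c) z.
  rewrite -tr ez !(addKK two0); move/nbrsP: dN => hd.
  by rewrite !hd // !inE eqxx ?orbT.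
have /and3P[/eqP z1 /eqP z2 /eqP fz] := pz.
have z0 : z != 0.
  by apply: contraTneq (oner_neq0 F) => e; rewrite -fz e eform0 eqxx.
have [w hb] := hbasis_complete two0 h z0 z1 z2.
have hw := frame_wp two0 ea f1 h hb fz.
have mem x : reflect (exists2 s, x = u + (s *: z + w) & wp s = eform a w + 1)
                     (x \in nbrs [set a; b; c; d]).
  have P := perp_adjP two0 f1 f2 h (u + x) hb fz.
  rewrite -/u ez (addKK two0) -tr !(addKK two0) in P.
  have -> : (x \in nbrs [set a; b; c; d]) =
            ([&& adj a x, adj b x & adj c x] && adj d x).
    apply/nbrsP/andP => [hx|[/and3P[ax bx cx] dx] y].
      by rewrite !hx // !inE eqxx ?orbT.
    by rewrite !inE => /orP[/orP[/orP[]|]|] /eqP ->.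
  apply: (iffP P) => -[s e hs]; exists s => //; last by rewrite e (addKK two0).
  by rewrite -e (addKK two0).
split=> [[t t1]|n1].
  apply/setP=> x; rewrite in_set0; apply/negP=> /mem[s _ hs].
  have /eqP[] := hw (s + t); rewrite (wpD two0) hs t1.
  by rewrite -addrA (addff two0) addr0.
have [s hs] := wp_index2 two0 hw n1.
have [_ hzw _ w1 [_ w2]] := hb.
have ws1 : wp (s + 1) = wp s by apply/eqP; rewrite (wp_eq two0) eqxx orbT.
pose e s := u + (s *: z + w).
have memE x : (x \in nbrs [set a; b; c; d]) = (x == e s) || (x == e (s + 1)).
  apply/mem/orP => [[t -> ht]|[]/eqP ->].
  - have : wp t == wp s by rewrite ht hs.
    by rewrite (wp_eq two0) => /orP[]/eqP ->; [left|right].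
  - by exists s.
  - by exists (s + 1); rewrite ?ws1.
exists (e s), (e (s + 1)); split; last by apply/setP => x; rewrite memE !inE.
have pe t : wp t = eform a w + 1 -> perp a (a + b) (a + c) (t *: z + w).
  move=> ht; suff /andP[//] : perp a (a + b) (a + c) (t *: z + w) &&
    adj (a + (a + b) + (a + c) + z) (a + (a + b) + (a + c) + (t *: z + w)).
  by apply/(perp_adjP two0 f1 f2 h _ hb fz); exists t.
have pes := pe s hs; have /and3P[/eqP s1 /eqP s2 /eqP fs] := pes.
have s0 : s *: z + w != 0.
  by apply: contraTneq (oner_neq0 F) => e0; rewrite -fs e0 eform0 eqxx.
(* To compare the two solutions, s z + w takes the place of [z] in [perp_adj]; its pairing with (s +
   1) z + w is s + (s + 1) = 1. *)
have [w' hb'] := hbasis_complete two0 h s0 s1 s2.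
rewrite /e (perp_adj two0 f1 f2 h hb' fs (pe (s + 1) _)) ?ws1 //.
rewrite !polE hzw (polC w z) hzw; apply/eqP; ring: two0.
Qed.

Lemma card_ge4P A : (3 < #|A|)%N -> exists a b c d,
  [/\ [/\ a \in A, b \in A, c \in A & d \in A], a != b, a != c, b != c
    & d \notin [set a; b; c]].
Proof.
move=> h; have /card_gt2P[a [b [c [[aA bA cA] [ab bc ca]]]]] := ltnW h.
have : (0 < #|A :\: [set a; b; c]|)%N.
  rewrite cardsD subn_gt0; apply: leq_ltn_trans h; apply: leq_trans (subset_leq_card (subsetIr _ _)) _.
  by rewrite setUC cardsU1 cards2; case: (_ \notin _); case: (_ != _).
case/card_gt0P => d; rewrite inE => /andP[dn dA].
by exists a, b, c, d; split=> //; rewrite eq_sym.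
Qed.

(* [K] consists of four members of [A] and their common neighbours. *)
Lemma hull A : adj_clique A -> ~ on_line A -> (3 < #|A|)%N ->
  exists K, [/\ adj_clique K, A \subset K, nbrs A = K :\: A,
    (exists t : F, wp t = 1) -> #|K| = 4%N & (forall t : F, wp t != 1) -> #|K| = 6%N].
Proof.
move=> cA nl /card_ge4P[a [b [c [d [[aA bA cA' dA] ab ac bc]]]]].
rewrite !inE !negb_or => /andP[/andP[da db] dc].
have [eA hA] := cA.
have ea := eA _ aA.
have h := noncollinear cA nl aA bA cA' ab ac bc.
have dN : d \in nbrs [set a; b; c].
  by apply/nbrsP => x; rewrite !inE => /orP[/orP[]|] /eqP ->; apply: hA; rewrite // eq_sym.
have [case4 case6] := nbrs4 ea (hA _ _ aA bA ab) (hA _ _ aA cA' ac) h dN.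
pose Q := [set a; b; c; d]; rewrite -/Q in case4 case6.
have QA : Q \subset A by apply/subsetP => x; rewrite !inE => /orP[/orP[/orP[]|]|] /eqP ->.
have cQ : #|Q| = 4%N.
  rewrite /Q setUC cardsU1 (setUC [set a; b]) cardsU1 cards2 !inE !negb_or.
  by rewrite da db dc ab !(eq_sym c) ac bc.
have hQ x y : x \in Q -> y \in Q -> x != y -> adj x y.
  by move=> xQ yQ; apply: hA; apply: (subsetP QA).
have nQ x : x \in nbrs Q -> x \notin Q.
  by move=> /nbrsP hx; apply/negP => /hx; rewrite adj_irr.
(* Members of [A] outside [Q] are adjacent to all of [Q], so [Q] and its common neighbours already
   contain [A]. *)
have AK : A \subset Q :|: nbrs Q.
  apply/subsetP => x xA; rewrite inE; case: (boolP (x \in Q)) => //= xQ.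
  apply/nbrsP => y yQ; apply: hA => //; first exact: (subsetP QA).
  by apply: contraNneq xQ => <-.
have sub : nbrs A \subset nbrs Q.
  by apply/subsetP => x /nbrsP hx; apply/nbrsP => y yQ; apply: hx; apply: (subsetP QA).
have clK : (forall x y, x \in nbrs Q -> y \in nbrs Q -> x != y -> adj x y) ->
    adj_clique (Q :|: nbrs Q).
  move=> hN; split=> [x|x y].
    rewrite inE => /orP[/(subsetP QA)/eA //|/nbrsP hx].
    by apply: (adj_ell two0 ea); apply: hx; rewrite !inE eqxx.
  rewrite inE => /orP[xQ|xN]; rewrite inE => /orP[yQ|yN] xy.
  - exact: hQ.
  - by move/nbrsP: yN => ->.
  - by rewrite (adjC two0); move/nbrsP: xN => ->.
  - exact: hN.
have nbE : adj_clique (Q :|: nbrs Q) -> nbrs A = (Q :|: nbrs Q) :\: A.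
  move=> [_ hK]; apply/setP => x; rewrite in_setD; apply/idP/andP => [xN|[xA xK]].
    split; last by rewrite inE (subsetP sub _ xN) orbT.
    by apply/negP => xA; move/nbrsP: xN => /(_ _ xA); rewrite adj_irr.
  apply/nbrsP => y yA; apply: hK => //; first exact: (subsetP AK).
  by apply: contraNneq xA => <-.
have cK : #|Q :|: nbrs Q| = (4 + #|nbrs Q|)%N.
  rewrite cardsU cQ disjoint_setI0 ?cards0 ?subn0 // disjoint_sym.
  by apply/pred0P => x /=; apply/negP => /andP[/nQ/negP].
exists (Q :|: nbrs Q); rewrite cK.
have cKK : adj_clique (Q :|: nbrs Q).
  apply: clK => x y.
  have [/existsP[t /eqP t1]|] := boolP [exists t : F, wp t == 1].
    by rewrite case4 ?inE //; exists t.
  rewrite negb_exists => /forallP /case6[e [e' [ee' ->]]].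
  rewrite !inE => /orP[]/eqP-> /orP[]/eqP->; rewrite ?eqxx // => _.
  by rewrite (adjC two0).
split=> //; first exact: nbE.
  by move/case4 => ->; rewrite cards0.
move/case6=> [e [e' [ee' ->]]]; rewrite cards2.
by case/andP: ee' => ->.
Qed.

Lemma card_nbrs A : adj_clique A -> ~ on_line A -> #|A| = 3%N -> #|nbrs A| = #|F|.+1.
Proof.
move=> cA nl c3; have /card_gt2P[a [b [c [[aA bA cA'] [ab bc ca]]]]] : (2 < #|A|)%N.
  by rewrite c3.
rewrite eq_sym in ca; have [eA hA] := cA.
have -> : A = [set a; b; c].
  apply/esym/eqP; rewrite eqEcard c3; apply/andP; split.
    by apply/subsetP => x; rewrite !inE => /orP[/orP[]|] /eqP ->.
  by rewrite setUC cardsU1 cards2 !inE !negb_or ab !(eq_sym c) bc ca.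
by apply: card_nbrs3; [exact: eA | exact: hA | exact: hA | exact: (noncollinear cA)].
Qed.

(** All quantifiers range over finite types. *)
Lemma on_line_dec A : on_line A \/ ~ on_line A.
Proof.
have [h|h] := boolP [exists a : V, exists p : V, [&& ell a, p != 0, eform a p == 0 &
    [forall (x | x \in A), exists t : F, x == a + t *: p]]].
  left; case/existsP: h => a /existsP[p /and4P[ea p0 /eqP fp /forall_inP h]].
  by exists a, p; split=> // x /h/existsP[t /eqP ->]; exists t.
right=> -[a [p [ea p0 fp hx]]]; case/negP: h; apply/existsP; exists a.
apply/existsP; exists p; rewrite ea p0 fp eqxx /=; apply/forall_inP => x /hx[t ->].
by apply/existsP; exists t.
Qed.

(** Two adjacent vectors span a line with singular direction; for fewer vectors [isotropic_ex]
    supplies a direction. *)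
Lemma small_on_line A : adj_clique A -> (#|A| <= 2)%N -> on_line A.
Proof.
move=> [eA hA]; case: (set_0Vmem A) => [->|[a aA]] cA.
  have [a ea] := ell_ex two0; have [p p0 fp] := isotropic_ex two0 a.
  by exists a, p; split=> // x; rewrite inE.
have ea := eA _ aA.
have [e|[b]] := set_0Vmem (A :\ a).
  have [p p0 fp] := isotropic_ex two0 a; exists a, p; split=> // x xA.
  exists 0; rewrite scale0r addr0; apply/eqP; apply: contraT => xa.
  by have := in_set0 x; rewrite -e !inE xa xA.
rewrite !inE => /andP[ba bA]; have ab := hA _ _ aA bA; rewrite eq_sym in ab.
exists a, (a + b); split=> //; [exact/adj_neq0/ab | exact/adj_form/ab |].
move=> x xA; have [->|xa] := eqVneq x a; first by exists 0; rewrite scale0r addr0.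
exists 1; rewrite scale1r (addKK two0); apply/eqP; apply: contraT => xb.
have : [set a; b; x] \subset A.
  by apply/subsetP => y; rewrite !inE => /orP[/orP[]|] /eqP ->.
move/subset_leq_card/leq_trans/(_ cA).
rewrite setUC cardsU1 cards2 !inE negb_or xa xb eq_sym ba //.
Qed.
End Cliques.

(** * From cliques of vectors to cliques of ovoids *)

Section Transfer.
Context (F : finFieldType) (two0 : (2%:R = 0 :> F)%R).
Local Notation V := 'rV[F]_4.
Implicit Types (A B : {set V}) (C D R : {set {set 'rV[F]_5}}).

Lemma mem_ov A d : ell d -> (ov d \in [set ov a | a in A]) = (d \in A).
Proof.
move=> ed; apply/imsetP/idP => [[a aA e]|dA]; last by exists d.
by rewrite (ov_inj two0 ed e).
Qed.

Lemma card_ov A : adj_clique A -> #|[set ov a | a in A]| = #|A|.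
Proof.
by move=> [eA _]; apply: card_in_imset => a b aA _; apply: (ov_inj two0); exact: eA.
Qed.

Lemma cliqueP C : clique C <-> exists2 A, adj_clique A & C = [set ov a | a in A].
Proof.
split=> [[eC tC]|[A [eA hA] ->]].
  have ovC X : X \in C -> exists2 a, ell a & X = ov a.
    by move/eC/(elliptic_ovoidP two0).
  exists [set a | ell a & ov a \in C].
    split=> [a|a b]; first by rewrite inE => /andP[].
    rewrite !inE => /andP[ea aC] /andP[eb bC] ab.
    rewrite -(tangentE two0 ea ab); apply/eqP/tC => //.
    by apply: contraNneq ab => /(ov_inj two0 ea) ->.
  apply/setP => X; apply/idP/imsetP => [XC|[a + ->]]; last by rewrite inE => /andP[].
  by have [a ea e] := ovC X XC; exists a; rewrite // inE ea -e.
split=> [_ /imsetP[a aA ->]|_ _ /imsetP[a aA ->] /imsetP[b bA ->] ab].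
  by apply/(elliptic_ovoidP two0); exists a => //; exact: eA.
have {}ab : a != b by apply: contraNneq ab => ->.
by apply/eqP; rewrite (tangentE two0 (eA _ aA) ab); exact: hA.
Qed.

Lemma rosette_clique R : rosette R -> clique R.
Proof. by move=> [p [_ _ eR tR]]; split=> // X Y XR YR XY; rewrite tR // cards1. Qed.

Lemma on_line_rosette A : on_line A ->
  exists R, rosette R /\ [set ov a | a in A] \subset R.
Proof.
move=> [a [p [ea p0 fp hA]]]; exists [set ov (a + t *: p)%R | t : F].
split; first exact: rosette_line.
by apply/subsetP => _ /imsetP[x /hA[t ->] ->]; exact: imset_f.
Qed.

Lemma nonlinear_adj C : nonlinear_clique C ->
  exists A, [/\ adj_clique A, ~ on_line A & C = [set ov a | a in A]].
Proof.
move=> [/cliqueP[A cA ->] nl]; exists A; split=> // /on_line_rosette; exact: nl.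
Qed.

(** [A] is nonempty so that [d] inherits ellipticity from a neighbour through [adj_ell]. *)
Lemma adj_cliqueU1 A d : adj_clique A -> A != set0 -> d \in nbrs A -> adj_clique (d |: A).
Proof.
move=> [eA hA] /set0Pn[a aA] /nbrsP hd; split=> [x|x y].
  rewrite !inE => /orP[/eqP ->|/eA //].
  exact: (adj_ell two0 (eA _ aA) (hd _ aA)).
rewrite !inE => /orP[/eqP ->|xA] /orP[/eqP ->|yA] //.
- by rewrite eqxx.
- by rewrite (adjC two0) hd.
- by rewrite hd.
- exact: hA.
Qed.

(** Adding one vertex to a clique means choosing a common neighbour, and distinct choices give
    distinct sets of ovoids by [ov_inj]. *)
Lemma count_extensions A : adj_clique A -> A != set0 ->
  count_eq (fun D => clique D /\ #|D| = #|A|.+1 /\ [set ov a | a in A] \subset D)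
           #|nbrs A|.
Proof.
move=> cA A0; have nA d : d \in nbrs A -> d \notin A.
  by move=> /nbrsP hd; apply/negP => /hd; rewrite adj_irr.
exists [set [set ov a | a in d |: A] | d in nbrs A]; split.
  apply: card_in_imset => d d' dN d'N e.
  have [eD _] := adj_cliqueU1 cA A0 dN.
  have : ov d \in [set ov a | a in d' |: A] by rewrite -e imset_f // setU11.
  by rewrite mem_ov ?eD ?setU11 // !inE (negbTE (nA _ dN)) orbF => /eqP.
move=> D; split=> [/imsetP[d dN ->]|[/cliqueP[B cB ->]]].
  have cD := adj_cliqueU1 cA A0 dN.
  split; first by apply/cliqueP; exists (d |: A).
  by rewrite card_ov // cardsU1 nA // imsetS // subsetUr.
rewrite card_ov // => -[kB sAB]; have [eB hB] := cB; have [eA _] := cA.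
have {}sAB : A \subset B.
  apply/subsetP => a aA; rewrite -(mem_ov B (eA _ aA)); apply: (subsetP sAB).
  exact: imset_f.
have : 0 < #|B :\: A| by rewrite cardsD (setIidPr sAB) kB subSnn.
case/card_gt0P=> d; rewrite inE => /andP[dA dB].
have eB' : B = d |: A.
  apply/esym/eqP; rewrite eqEcard cardsU1 dA kB leqnn andbT subUset sAB andbT.
  by rewrite sub1set.
apply/imsetP; exists d; last by rewrite -eB'.
apply/nbrsP => a aA; apply: hB => //; first exact: (subsetP sAB).
by apply: contraNneq dA => <-.
Qed.

Lemma maximal_nbrs A : maximal_clique [set ov a | a in A] -> adj_clique A ->
  A != set0 -> nbrs A = set0.
Proof.
move=> [_ mx] cA A0; apply/setP => d; rewrite in_set0; apply/negP => dN.
have cD := adj_cliqueU1 cA A0 dN.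
have e : [set ov a | a in d |: A] = [set ov a | a in A].
  by apply: mx; [apply/cliqueP; exists (d |: A) | rewrite imsetS // subsetUr].
have : ov d \in [set ov a | a in A] by rewrite -e imset_f // setU11.
have [eD _] := cD; rewrite mem_ov ?eD ?setU11 // => dA.
by move/nbrsP: dN => /(_ _ dA); rewrite adj_irr.
Qed.

(** The rosette is itself a clique, so maximality makes [C] equal to it. *)
Lemma maximal_linear C R : maximal_clique C -> rosette R -> C \subset R -> #|C| = #|F|.
Proof.
move=> [_ mx] rR /(mx _ (rosette_clique rR)) <-.
by case: rR => p [_ ->].
Qed.

(** Off a line there are at least three vertices, and not exactly three because a triangle has q + 1
    common neighbours. With four or more, [hull] applies, and the absence of common neighbours makes
    [A] the whole of [K]. *)
Lemma maximal_card C : maximal_clique C ->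
  (exists R, rosette R /\ C \subset R) \/
  ((exists t : F, wp t = 1%R) -> #|C| = 4) /\ ((forall t : F, wp t != 1%R) -> #|C| = 6).
Proof.
move=> mC; have [/cliqueP[A cA eC] _] := mC.
have [/on_line_rosette|nl] := on_line_dec A; first by rewrite -eC; left.
right; rewrite eC card_ov //; rewrite eC in mC.
have A3 : 2 < #|A| by rewrite ltnNge; apply/negP => /(small_on_line two0 cA).
have A0 : A != set0 by rewrite -card_gt0 (leq_trans _ A3).
have n0 := maximal_nbrs mC cA A0.
have A4 : 3 < #|A|.
  rewrite ltn_neqAle A3 andbT eq_sym; apply/eqP => /(card_nbrs two0 cA nl).
  by rewrite n0 cards0.
have [K [cK AK nK k4 k6]] := hull two0 cA nl A4.
have -> : A = K; last by [].
apply/eqP; rewrite eqEsubset AK /= -setD_eq0 -nK n0 //.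
Qed.
End Transfer.

(** * Deduction of the four statements for q = 2^n *)

Theorem theorem2 (n : nat) (F : finFieldType) (hn : 0 < n) (hF : #|F| = 2 ^ n) :
  let q := 2 ^ n in
  (* (1) *)
  (~~ odd n ->
     (forall C : {set {set 'rV[F]_5}}, @maximal_clique F C -> #|C| = q \/ #|C| = 4) /\
     (4 < q ->
        (forall C : {set {set 'rV[F]_5}}, @maximal_clique F C -> #|C| = q -> @linear_clique F C) /\
        (forall C : {set {set 'rV[F]_5}}, @maximal_clique F C -> #|C| = 4 -> @nonlinear_clique F C))) /\
  (* (2) *)
  (odd n -> 2 < q ->
     (forall C : {set {set 'rV[F]_5}}, @maximal_clique F C -> #|C| = q \/ #|C| = 6) /\
     (forall C : {set {set 'rV[F]_5}}, @clique F C -> #|C| = q -> @linear_clique F C) /\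
     (forall C : {set {set 'rV[F]_5}}, @maximal_clique F C -> #|C| = 6 -> @nonlinear_clique F C)) /\
  (* (3) *)
  (forall C : {set {set 'rV[F]_5}}, @nonlinear_clique F C -> #|C| = 3 ->
     count_eq (fun D : {set {set 'rV[F]_5}} => @nonlinear_clique F D /\ #|D| = 4 /\ C \subset D) q.+1) /\
  (* (4) *)
  (odd n ->
     (forall C : {set {set 'rV[F]_5}}, @nonlinear_clique F C -> #|C| = 4 ->
        count_eq (fun D : {set {set 'rV[F]_5}} => @clique F D /\ #|D| = 5 /\ C \subset D) 2) /\
     (forall C : {set {set 'rV[F]_5}}, @nonlinear_clique F C -> #|C| = 5 ->
        count_eq (fun D : {set {set 'rV[F]_5}} => @clique F D /\ #|D| = 6 /\ C \subset D) 1)).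
Proof.
move=> q; have two0 : (2%:R = 0 :> F)%R.
  by have /andP[_ /eqP] := card_finPcharP hF (isT : prime 2).
have max_nonlinear (C : {set {set 'rV[F]_5}}) : maximal_clique C -> #|C| != q -> nonlinear_clique C.
  move=> mC Cq; split; first by case: mC.
  by move=> [R [rR CR]]; move: Cq; rewrite (maximal_linear mC rR CR) hF eqxx.
split; [|split; [|split]].
- move=> en; have one := wp_one_even two0 hF hn en.
  split=> [C mC|q4].
    have [[R [rR CR]]|[-> //]] := maximal_card two0 mC; last by right.
    by left; rewrite (maximal_linear mC rR CR).
  split=> C mC Ck; last by apply: max_nonlinear; rewrite // Ck neq_ltn q4.
  split; first by case: mC.
  have [//|[k4 _]] := maximal_card two0 mC.
  by move: q4; rewrite -Ck k4 // ltnn.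
- move=> on q2; have one := wp_one_odd two0 hF on.
  (* An odd n with 2^n > 2 is at least 3, so q is at least 8. *)
  have q6 : 6 < q.
    move: on q2; rewrite /q; case: (n) => [|[|[|m]]] //= _ _.
    by rewrite !expnS; have := expn_gt0 2 m; lia.
  split=> [C mC|]; last split=> C.
  + have [[R [rR CR]]|[_ -> //]] := maximal_card two0 mC; last by right.
    by left; rewrite (maximal_linear mC rR CR).
  (* No maximality is assumed here: a non-linear clique of size q would lie in a hull of 6 < q
     vertices. *)
  + move=> cC Cq; split=> //; have /(cliqueP two0)[A cA eC] := cC.
    have [/(on_line_rosette two0)|nl] := on_line_dec A; first by rewrite -eC.
    have Aq : #|A| = q by rewrite -Cq eC card_ov.
    have [|K [_ AK _ _ k6]] := hull two0 cA nl; first by rewrite Aq (leq_trans _ q6).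
    by have := subset_leq_card AK; rewrite Aq k6 // leqNgt q6.
  + by move=> mC C6; apply: max_nonlinear; rewrite // C6 neq_ltn q6.
- move=> C nC; have [A [cA nl eC]] := nonlinear_adj two0 nC.
  rewrite eC card_ov // => A3; have A0 : A != set0 by rewrite -card_gt0 A3.
  have [S [cS hS]] := count_extensions two0 cA A0.
  exists S; rewrite cS (card_nbrs two0 cA nl A3) hF; split=> // D.
  rewrite hS A3; split=> [[cD [D4 AD]]|[[cD _] [D4 AD]]]; do ?split=> //.
  (* A rosette containing [D] would contain [C] too. *)
  by case: nC => _ nC [R [rR DR]]; apply: nC; exists R; rewrite eC (subset_trans AD).
- move=> on; have one := wp_one_odd two0 hF on.
  (* The one-vertex extensions correspond to the 6 - k vertices of the hull outside the clique; k =
     4 and k = 5 give 2 and 1. *)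
  have ext k (C : {set {set 'rV[F]_5}}) : nonlinear_clique C -> #|C| = k -> 3 < k ->
      count_eq (fun D : {set {set 'rV[F]_5}} => clique D /\ #|D| = k.+1 /\ C \subset D)
        (6 - k).
    move=> nC; have [A [cA nl ->]] := nonlinear_adj two0 nC.
    rewrite card_ov // => Ak k3; have A4 : 3 < #|A| by rewrite Ak.
    have [K [_ AK nK _ k6]] := hull two0 cA nl A4.
    rewrite -Ak -k6 // -(setIidPr AK) -cardsD (setIidPr AK) -nK.
    by apply: count_extensions; rewrite // -card_gt0 (leq_trans _ A4).
  by split=> C nC Ck; exact: (ext _ _ nC Ck).
Qed.
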